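(* Let $\mathcal G$ be a finite directed metric tree on which a non-negative weak solution $u$ of the network Burgers' equation is considered, fix a time $t\in[0,T)$, and let $v_i$ be a vertex which is not a sink. For an edge $e_j$ incident to $v_i$ write $u_j(v_i,t^-)\in[0,\infty)$ for the value of the solution at the end $v_i$ of $e_j$ before the flow through the vertex, and $u(v_i,t^-)\in[0,\infty)^{\deg(v_i)}$ for the vector of these values. With the minimal and maximal transmission solvers $(TS_i^m)^\star$, $(TS_i^M)^\star$ defined in the context, the following hold. (i) There exists a unique minimal transmission solver $(TS_i^m)^{\star}$ at $v_i$, and for every $u(v_i,t^-)\in[0,\infty)^{\deg(v_i)}$ its $j$-th coordinate is $$\big((TS_i^m)^{\star}u(v_i,t^-)\big)_j=\begin{cases}u_j(v_i,t^-) & \text{for } e_j\in D_i^{in},\\[1mm] \dfrac{1}{\sqrt{\deg_-(v_i)}}\sqrt{\sum_{s:\,e_s\in D_i^{in}}u_s^2(v_i,t^-)} & \text{for } e_j\in D_i^{out}.\end{cases}$$ (ii) There exists a unique maximal transmission solver $(TS_i^M)^{\star}$ at $v_i$, and for every $u(v_i,t^-)\in[0,\infty)^{\deg(v_i)}$ its $j$-th coordinate is $$\big((TS_i^M)^{\star}u(v_i,t^-)\big)_j=\begin{cases}u_j(v_i,t^-) & \text{for } e_j\in D_i^{in},\\[1mm] \sqrt{\sum_{s:\,e_s\in D_i^{in}}u_s^2(v_i,t^-)} & \text{for } j=k,\\[1mm] 0 & \text{for } e_j\in D_i^{out}\setminus\{e_k\},\end{cases}$$ where $k:=\min\{j:\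 e_j\in D_i^{out}\}$.
   Context: A directed metric tree is a finite, connected directed graph with vertices $v_i$ and edges $e_j$, $j\in J=\{1,\dots,m\}$, without directed cycles and multiple edges, where each edge $e_j$ is identified with an interval $[0,l_j]$ parametrised along its direction. $D_i^{in}$ (resp. $D_i^{out}$) is the set of edges ending (resp. starting) at $v_i$; $\deg_+(v_i)=|D_i^{in}|$, $\deg_-(v_i)=|D_i^{out}|$, $\deg(v_i)=\deg_+(v_i)+\deg_-(v_i)$. A sink is a vertex with $D_i^{out}=\emptyset$. The edges are enumerated by $J$, and this enumeration orders $D_i^{out}$. Solutions of the network Burgers' equation are functions $u=(u_j)_{j\in J}$, $u_j\ge 0$, solving $\partial_t u_j+u_j\partial_xu_j=0$ weakly on the edges. The theorem only concerns the map sending the vector of values $u(v_i,t^-)$ on the edges incident to $v_i$ just before time $t$ to the vector of values $u(v_i,t^+)$ just after. A transmission solver at $v_i$ is a map $TS_i:[0,\infty)^{\deg(v_i)}\to[0,\infty)^{\deg(v_i)}$, $u(v_i,t^-)\mapsto u(v_i,t^+)$, whose values satisfy the Kirchhoff condition $$\sum_{e_j\in D_i^{in}}u_j^2(v_i,t^+)=\sum_{e_j\in D_i^{out}}u_j^2(v_i,t^+).$$ The change of energy at $v_i$ is $$\mathcal E_i=\sum_{e_j\in D_i^{in}}\mathcal E_{ij}^{+}+\sum_{e_j\in D_i^{out}}\mathcal E_{ij}^{-},$$ $$\mathcal E_{ij}^{\pm}=\frac{u_j^3(v_i,t^{\mp})-u_j^3(v_i,t^{\pm})}{3}-\frac{\big(u_j(v_i,t^{\mp})-u_j(v_i,t^{\pm})\big)^3}{12}\,\theta\big(u_j(v_i,t^{\mp})-u_j(v_i,t^{\pm})\big),$$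 where $\theta$ is the Heaviside step function (upper signs for $\mathcal E^+_{ij}$, lower signs for $\mathcal E^-_{ij}$). Conditions: (LC) $u_j(v_i,t^+)=u_j(v_i,t^-)$ for $e_j\in D_i^{in}$. (DF) $u_j(v_i,t^+)\ge u_k(v_i,t^+)$ whenever $j<k$ and $e_j,e_k\in D_i^{out}$. $TS_i^m$ is the transmission solver assigning to each $u(v_i,t^-)$ the vector $u(v_i,t^+)$ that minimizes $\mathcal E_i$ among all non-negative vectors satisfying the Kirchhoff condition and (LC). $TS_i^M$ is the transmission solver assigning to each $u(v_i,t^-)$ the vector $u(v_i,t^+)$ that maximizes $\mathcal E_i$ among all non-negative vectors satisfying the Kirchhoff condition, (LC) and (DF). For $z\in\{m,M\}$, the minimal ($z=m$), resp. maximal ($z=M$), transmission solver at $v_i$ is $$(TS_i^z)^\star u(v_i,t^-)=\lim_{n\to\infty}(TS_i^z)^{(n)}u(v_i,t^-)\quad\text{for every }u(v_i,t^-)\in[0,\infty)^{\deg(v_i)},$$ where $(TS_i^z)^{(n)}$ is the $n$-fold composition of $TS_i^z$ with itself. The assertion that it exists uniquely includes the well-definedness of $TS_i^z$ and the existence of the limit. *)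

(* Defs.v *)
(* MathComp / MathComp-Analysis *)
From HB Require Import structures.
From mathcomp Require Import all_boot all_order all_algebra.
From mathcomp Require Import all_classical all_reals all_analysis.

Set Implicit Arguments.
Unset Strict Implicit.
Unset Printing Implicit Defensive.

Import Order.TTheory GRing.Theory Num.Theory.
Import numFieldNormedType.Exports.

Local Open Scope classical_set_scope.
Local Open Scope ring_scope.

(* A tree is only required to be connected (ignoring directions), free of
   directed cycles and of parallel edges. The edge e_(j+1) is j : 'I_m, and it
   is identified with [0, edge_length j], 0 being the end edge_src j. *)
Record directed_metric_tree (R : realType) := DirectedMetricTree {
  vertex : finType;
  edge_count : nat;
  edge_src : 'I_edge_count -> vertex;
  edge_tgt : 'I_edge_count -> vertex;
  edge_length : 'I_edge_count -> R;
  edge_rel := [rel x y | [exists j, (edge_src j == x) && (edge_tgt j == y)]];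
  edge_length_gt0 : forall j, 0 < edge_length j;
  no_multiple_edges : injective (fun j => (edge_src j, edge_tgt j));
  no_directed_cycle : forall s : seq vertex, cycle edge_rel s -> s = [::];
  tree_connected :
    forall x y, connect [rel a b | edge_rel a b || edge_rel b a] x y }.

Definition D_in (R : realType) (G : directed_metric_tree R) (v : vertex G) :
  {set 'I_(edge_count G)} := [set j | edge_tgt j == v]%SET.

Definition D_out (R : realType) (G : directed_metric_tree R) (v : vertex G) :
  {set 'I_(edge_count G)} := [set j | edge_src j == v]%SET.

Definition sink (R : realType) (G : directed_metric_tree R) (v : vertex G) :
  bool := D_out v == finset.set0.

Definition deg_minus (R : realType) (G : directed_metric_tree R)
  (v : vertex G) : nat := #|D_out v|.

Definition incident (R : realType) (G : directed_metric_tree R)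
  (v : vertex G) := {j : 'I_(edge_count G) | j \in D_in v :|: D_out v}.

(* [0, +oo[ ^ deg(v): as there are no loops, incident v has
   deg_+(v) + deg_-(v) elements. *)
Definition vertex_values (R : realType) (G : directed_metric_tree R)
  (v : vertex G) := incident v -> {nonneg R}.

Definition heaviside (R : realType) (x : R) : R := if 0 <= x then 1 else 0.

Definition energy_loss (R : realType) (p q : R) : R :=
  (p ^+ 3 - q ^+ 3) / 3 - (p - q) ^+ 3 / 12 * heaviside (p - q).

Definition energy_change (R : realType) (G : directed_metric_tree R)
    (v : vertex G) (before after : vertex_values v) : R :=
  \sum_(j : incident v | val j \in D_in v)
     energy_loss (before j)%:num (after j)%:num +
  \sum_(j : incident v | val j \in D_out v)
     energy_loss (after j)%:num (before j)%:num.

Definition kirchhoff (R : realType) (G : directed_metric_tree R)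
    (v : vertex G) (w : vertex_values v) : Prop :=
  \sum_(j : incident v | val j \in D_in v) (w j)%:num ^+ 2 =
  \sum_(j : incident v | val j \in D_out v) (w j)%:num ^+ 2.

Definition LC (R : realType) (G : directed_metric_tree R) (v : vertex G)
    (before after : vertex_values v) : Prop :=
  forall j : incident v, val j \in D_in v -> after j = before j.

Definition DF (R : realType) (G : directed_metric_tree R) (v : vertex G)
    (after : vertex_values v) : Prop :=
  forall j k : incident v, val j \in D_out v -> val k \in D_out v ->
    (val j < val k)%N -> (after k)%:num <= (after j)%:num.

Definition transmission_solver (R : realType) (G : directed_metric_tree R)
    (v : vertex G) (TS : vertex_values v -> vertex_values v) : Prop :=
  forall u, kirchhoff (TS u).

Definition is_TSm (R : realType) (G : directed_metric_tree R) (v : vertex G)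
    (TS : vertex_values v -> vertex_values v) : Prop :=
  transmission_solver TS /\
  forall u, LC u (TS u) /\
    forall w, kirchhoff w -> LC u w ->
      energy_change u (TS u) <= energy_change u w.

Definition is_TSM (R : realType) (G : directed_metric_tree R) (v : vertex G)
    (TS : vertex_values v -> vertex_values v) : Prop :=
  transmission_solver TS /\
  forall u, LC u (TS u) /\ DF (TS u) /\
    forall w, kirchhoff w -> LC u w -> DF w ->
      energy_change u w <= energy_change u (TS u).

Definition is_iterated_limit (R : realType) (G : directed_metric_tree R)
    (v : vertex G) (TS TSstar : vertex_values v -> vertex_values v) : Prop :=
  forall u (j : incident v),
    (fun n : nat => (iter n TS u j)%:num) @ \oo --> (TSstar u j)%:num.

(* `unique` makes the well-definedness of the solver being iterated part of
   the notion. *)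
Definition is_minimal_solver (R : realType) (G : directed_metric_tree R)
    (v : vertex G) (TSstar : vertex_values v -> vertex_values v) : Prop :=
  transmission_solver TSstar /\
  exists TS, unique (@is_TSm R G v) TS /\ is_iterated_limit TS TSstar.

Definition is_maximal_solver (R : realType) (G : directed_metric_tree R)
    (v : vertex G) (TSstar : vertex_values v -> vertex_values v) : Prop :=
  transmission_solver TSstar /\
  exists TS, unique (@is_TSM R G v) TS /\ is_iterated_limit TS TSstar.

Definition first_out (R : realType) (G : directed_metric_tree R)
    (v : vertex G) (k : incident v) : Prop :=
  val k \in D_out v /\
  forall j : incident v, val j \in D_out v -> (val k <= val j)%N.

(* Main.v *)
Require Import Defs.
From HB Require Import structures.
From mathcomp Require Import all_boot all_order all_algebra.
From mathcomp Require Import all_classical all_reals all_analysis.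
From mathcomp Require Import ring lra.

Set Implicit Arguments.
Unset Strict Implicit.
Unset Printing Implicit Defensive.

Import Order.TTheory GRing.Theory Num.Theory.
Import numFieldNormedType.Exports.

Local Open Scope classical_set_scope.
Local Open Scope ring_scope.

(** Under (LC) the incoming terms of the energy change vanish, and the Kirchhoff
condition fixes the sum [S] of the squares of the outgoing values. Both problems
are therefore about the sum over the outgoing edges of
[g_c(p) = (p^3 - c^3) / 3 - (p - c)_+^3 / 12], where [c] is the value before the
vertex, on the sphere of squared radius [S].

Minimum. As a function of [p^2], [g_c] is strictly convex, with derivative
[p / 2 - (p - c)_+^2 / (8 p)]. By Lagrange's condition the minimizer gives all
outgoing edges a common value [mu / 2] of this derivative, which makes the
outgoing value an explicit function [equimarginal c mu]; the intermediate value
theorem provides the level [mu] that meets the constraint, and the tangent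
inequality [energy_loss_tangent] shows that the resulting vector is the strict
minimizer. It depends on the previous outgoing values, but
[equimarginal c mu] lies between [mu] and [mu + (mu - c)_+ / 3]. Let [A] be the
common value of the equal distribution, that is, the quadratic mean of the
outgoing values. It lies between the smallest and the largest new value, so that
if all previous values are at least [A - e], then all new ones are within
[e / 3] of [A]
([equimarginal_contraction]). Starting from nonnegative values, that is with
[e = A], the iterates converge geometrically to the equal distribution.

Maximum. Let [a] be the value on the first outgoing edge, which by (DF) is the
largest one, and [b] the square root of [S]. Raising that value from [a] to [b]
gains at least [(b^3 - a^3) / 4], whatever [c] is ([energy_loss_growth]), while
emptying the other edges costs at most the sum of their cubes over 3, hence at
most [a (b^2 - a^2) / 3]. For [a < b] the gain is larger, so sending everything
into the first edge is the strict maximizer. This solver ignores the previous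
outgoing values, hence it is idempotent and equals its own iterated limit. *)

(** * Energy loss on a single edge *)

Lemma energy_loss_le (R : realType) (p q : R) :
  p <= q -> energy_loss p q = (p ^+ 3 - q ^+ 3) / 3.
Proof.
move=> le_pq; rewrite /energy_loss /heaviside subr_ge0.
case: ifP => [le_qp|_]; last by rewrite mulr0 subr0.
have -> : p = q by apply/le_anti; rewrite le_pq le_qp.
ring.
Qed.

Lemma energy_loss_ge (R : realType) (p q : R) :
  q <= p -> energy_loss p q = (p ^+ 3 - q ^+ 3) / 3 - (p - q) ^+ 3 / 12.
Proof.
by move=> le_qp; rewrite /energy_loss /heaviside subr_ge0 le_qp mulr1.
Qed.

Lemma energy_lossxx (R : realType) (p : R) : energy_loss p p = 0.
Proof. by rewrite energy_loss_le// subrr mul0r. Qed.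

(** The value [p] at which the derivative of [energy_loss p c] with respect to
[p^2] equals [mu / 2]: it is [mu] itself when [mu <= c], and otherwise the
larger root of [3 p^2 + 2 c p - c^2 = 4 mu p]. Truncating [c] at [mu] merges
the two cases in one formula, which is visibly continuous in [mu]. *)
Definition equimarginal (R : realType) (c mu : R) : R :=
  let d := Num.min c mu in
  (2 * mu - d + 2 * Num.sqrt (mu ^+ 2 - d * mu + d ^+ 2)) / 3.

Lemma equimarginal_sat (R : realType) (c mu : R) :
  0 <= mu -> mu <= c -> equimarginal c mu = mu.
Proof.
move=> mu0 le_mc; rewrite /equimarginal min_r//.
have -> : mu ^+ 2 - mu * mu + mu ^+ 2 = mu ^+ 2 by ring.
by rewrite sqrtr_sqr ger0_norm//; field.
Qed.

Lemma equimarginal_quadratic (R : realType) (c mu : R) : c <= mu ->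
  4 * mu * equimarginal c mu =
  3 * equimarginal c mu ^+ 2 + 2 * c * equimarginal c mu - c ^+ 2.
Proof.
move=> le_cm; rewrite /equimarginal min_l//.
have disc0 : 0 <= mu ^+ 2 - c * mu + c ^+ 2 by nra.
set p := _ / 3.
have : (3 * p - (2 * mu - c)) ^+ 2 = 4 * (mu ^+ 2 - c * mu + c ^+ 2).
  by rewrite -(sqr_sqrtr disc0) /p; field.
lra.
Qed.

Lemma equimarginal_ge (R : realType) (c mu : R) :
  0 <= c -> 0 <= mu -> mu <= equimarginal c mu.
Proof.
move=> c0 mu0; case: (leP mu c) => [le_mc|lt_cm].
  by rewrite equimarginal_sat.
rewrite /equimarginal min_l ?(ltW lt_cm)//.
suff : (mu + c) / 2 <= Num.sqrt (mu ^+ 2 - c * mu + c ^+ 2) by lra.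
rewrite -[leLHS]ger0_norm ?divr_ge0 ?addr_ge0// -sqrtr_sqr ler_sqrt; last by nra.
have := sqr_ge0 (mu - c); nra.
Qed.

(** For [c < mu] the defining equation reads [4 p (p - mu) = (p - c)^2], and
[p - c <= p] turns it into [3 (p - mu) <= mu - c]. *)
Lemma equimarginal_overshoot (R : realType) (c mu e : R) :
  0 <= c -> 0 <= mu -> 0 <= e -> mu <= c + 3 * e ->
  equimarginal c mu <= mu + e.
Proof.
move=> c0 mu0 e0 le_e; case: (leP mu c) => [le_mc|lt_cm].
  by rewrite equimarginal_sat// lerDl.
have p_ge := equimarginal_ge c0 mu0.
have := equimarginal_quadratic (ltW lt_cm).
set p := equimarginal c mu in p_ge *.
move=> pE.
have p0 : 0 < p by lra.
suff : p * (3 * (p - mu)) <= p * (mu - c) by rewrite ler_pM2l//; lra.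
nra.
Qed.

(** A strictly convex function lies strictly above its tangents: here the
function is [energy_loss], the variable is the square of the outgoing value, and
the slope at [equimarginal c mu] is [mu / 2]. *)
Lemma energy_loss_tangent (R : realType) (c mu w : R) :
  0 <= c -> 0 <= mu -> 0 <= w -> w != equimarginal c mu ->
  mu / 2 * (w ^+ 2 - equimarginal c mu ^+ 2) <
  energy_loss w c - energy_loss (equimarginal c mu) c.
Proof.
move=> c0 mu0 w0; case: (leP mu c) => [le_mc|lt_cm].
  rewrite equimarginal_sat// (energy_loss_le le_mc) => neq.
  have sq0 : 0 < (w - mu) ^+ 2 by rewrite exprn_even_gt0// subr_eq0.
  have wmu : 0 < 3 * w + 2 * mu.
    by move: neq; rewrite neq_lt => /orP[]; lra.
  have pos := mulr_gt0 sq0 wmu.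
  case: (leP w c) => [le_wc|/ltW le_cw].
    by rewrite energy_loss_le//; nra.
  rewrite energy_loss_ge//.
  have le1 : (w - c) ^+ 2 <= (w - mu) ^+ 2 by rewrite ler_sqr ?nnegrE; lra.
  have le2 : (w - c) ^+ 2 * (w - c) <= (w - mu) ^+ 2 * w.
    by apply: ler_pM => //; [exact: sqr_ge0|lra|lra].
  nra.
have p_ge := equimarginal_ge c0 mu0.
have := equimarginal_quadratic (ltW lt_cm).
set p := equimarginal c mu in p_ge *.
move=> pE neq.
have p0 : 0 < p by lra.
have lt_cp : c < p by lra.
have sq0 : 0 < (w - p) ^+ 2 by rewrite exprn_even_gt0// subr_eq0.
rewrite (energy_loss_ge (ltW lt_cp)).
rewrite -(ltr_pM2l p0) -subr_gt0.
(* The gap between the function and its tangent, multiplied by [p] to clear the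
   denominator of the slope. *)
set T := _ - _.
have slopeE : p * (mu / 2 * (w ^+ 2 - p ^+ 2)) =
              4 * mu * p * (w ^+ 2 - p ^+ 2) / 8 by field.
case: (leP c w) => [le_cw|lt_wc].
  have -> : T = (w - p) ^+ 2 * (p * (2 * w + p) + c ^+ 2) / 8.
    rewrite /T energy_loss_ge//.
    by rewrite slopeE pE; field.
  rewrite divr_gt0// mulr_gt0// ltr_wpDr ?sqr_ge0// mulr_gt0//; lra.
have -> : T = (w - p) ^+ 2 * (p * (2 * w + p) + c ^+ 2) / 8 -
              p * (c - w) ^+ 3 / 12.
  rewrite /T (energy_loss_le (ltW lt_wc)).
  by rewrite slopeE pE; field.
(* Below [c] the correction [(w - c)_+^3] is absent. The resulting defect is
   absorbed because [c - w] is at most both [p - w] and [p]. *)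
have le1 : (c - w) ^+ 2 <= (w - p) ^+ 2.
  by rewrite -[leRHS]sqrrN ler_sqr ?nnegrE; lra.
have le2 : (c - w) ^+ 2 * (c - w) <= (w - p) ^+ 2 * p.
  by apply: ler_pM => //; [exact: sqr_ge0|lra|lra].
have le3 : p * ((c - w) ^+ 2 * (c - w)) <= p * ((w - p) ^+ 2 * p).
  by rewrite ler_pM2l.
have g1 : 0 < (w - p) ^+ 2 * p ^+ 2 by rewrite mulr_gt0// exprn_gt0.
have g2 : 0 <= (w - p) ^+ 2 * (p * w).
  by apply: mulr_ge0; [exact: sqr_ge0|exact: mulr_ge0 (ltW p0) w0].
have g3 : 0 <= (w - p) ^+ 2 * c ^+ 2 by rewrite mulr_ge0// ?sqr_ge0.
move: le3 g1 g2 g3; rewrite ![p * (_ * _)]mulrA.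
nra.
Qed.

(** * Distributing a prescribed sum of squares *)

Lemma continuous_equimarginal (R : realType) (c : R) :
  continuous (equimarginal c).
Proof.
move=> x; rewrite /equimarginal /=.
have cmin : Num.min c y @[y --> x] --> Num.min c x.
  exact: (continuous_min (cvg_cst (c : R^o)) (@cvg_id _ (nbhs (x : R^o)))).
apply: cvgM; last exact: cvg_cst.
apply: cvgD.
  by apply: cvgB => //; apply: cvgM; [exact: cvg_cst|exact: cvg_id].
apply: cvgM; first exact: cvg_cst.
apply: continuous_cvg; first exact: sqrt_continuous.
apply: cvgD; last exact: cvgM.
apply: cvgB; last by apply: cvgM => //; exact: cvg_id.
by apply: cvgM; exact: cvg_id.
Qed.

Lemma exists_equimarginal_level (R : realType) (I : finType) (P : pred I)
    (c : I -> R) (S : R) :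
  (exists i, P i) -> (forall i, 0 <= c i) -> 0 <= S ->
  exists2 mu, 0 <= mu & \sum_(i | P i) equimarginal (c i) mu ^+ 2 = S.
Proof.
move=> [i Pi] c0 S0.
pose f mu := \sum_(i | P i) equimarginal (c i) mu ^+ 2.
have contf : continuous f.
  apply: continuous_big; first exact: add_continuous.
  by move=> j _ x; apply: cvgM; exact: continuous_equimarginal.
have f0 : f 0 = 0.
  by rewrite /f big1// => j _; rewrite equimarginal_sat// expr0n.
(* One edge alone already receives at least [mu], so the level [sqrt S] is
   high enough. *)
have fS : S <= f (Num.sqrt S).
  rewrite /f (bigD1 i)//= -[leLHS]addr0 lerD ?sumr_ge0//; last first.
    by move=> j _; exact: sqr_ge0.
  rewrite -[leLHS]sqr_sqrtr// ler_sqr ?nnegrE ?sqrtr_ge0//.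
    by rewrite equimarginal_ge ?sqrtr_ge0.
  by rewrite (le_trans (sqrtr_ge0 S))// equimarginal_ge ?sqrtr_ge0.
have [||mu mu_in fmu] := @IVT R f 0 (Num.sqrt S) S (sqrtr_ge0 S).
- exact: continuous_subspaceT.
- by rewrite f0 ge_min le_max S0 fS orbT.
- by exists mu => //; move: mu_in; rewrite in_itv/= => /andP[].
Qed.

(** The slopes of the tangent inequality are the same on all edges, so the linear
terms cancel between two competitors with the same sum of squares. *)
Lemma sum_energy_loss_equimarginal_lt (R : realType) (I : finType)
    (P : pred I) (c w : I -> R) (mu : R) :
  (forall i, 0 <= c i) -> (forall i, 0 <= w i) -> 0 <= mu ->
  \sum_(i | P i) w i ^+ 2 = \sum_(i | P i) equimarginal (c i) mu ^+ 2 ->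
  (exists2 i, P i & w i != equimarginal (c i) mu) ->
  \sum_(i | P i) energy_loss (equimarginal (c i) mu) (c i) <
  \sum_(i | P i) energy_loss (w i) (c i).
Proof.
move=> c0 w0 mu0 eq_sq [i Pi neq_i]; rewrite -subr_gt0 -sumrB.
have tot0 : \sum_(j | P j)
    mu / 2 * (w j ^+ 2 - equimarginal (c j) mu ^+ 2) = 0.
  by rewrite -mulr_sumr sumrB eq_sq subrr mulr0.
rewrite -[ltLHS]tot0 (bigD1 i)//= [ltRHS](bigD1 i)//=.
rewrite ltr_leD ?energy_loss_tangent//.
apply: ler_sum => j _; have [->|neq] := eqVneq (w j) (equimarginal (c j) mu).
  by rewrite !subrr mulr0.
exact/ltW/energy_loss_tangent.
Qed.

(** The quadratic mean [A] satisfies [mu <= A], since every new value is at least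
[mu]; the overshoot above [mu] is then at most [e / 3], which also gives
[A <= mu + e / 3]. A lower bound on the previous values suffices: values far
above [A] are cut down to [mu] in a single step. *)
Lemma equimarginal_contraction (R : realType) (I : finType) (P : pred I)
    (c : I -> R) (mu A e : R) :
  (forall i, 0 <= c i) -> 0 <= mu -> 0 <= A -> 0 <= e ->
  \sum_(i | P i) equimarginal (c i) mu ^+ 2 = #|P|%:R * A ^+ 2 ->
  (forall i, P i -> A - e <= c i) ->
  forall i, P i -> `|equimarginal (c i) mu - A| <= e / 3.
Proof.
move=> c0 mu0 A0 e0 sumE c_ge i Pi.
have cardP0 : 0 < #|P|%:R :> R by rewrite ltr0n; apply/card_gt0P; exists i.
have constE x : \sum_(j | P j) x = #|P|%:R * x :> R.
  by rewrite sumr_const mulr_natl.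
have le_muA : mu <= A.
  rewrite -(@ler_sqr R) ?nnegrE// -(ler_pM2l cardP0) -sumE -constE.
  apply: ler_sum => j Pj.
  by rewrite ler_sqr ?nnegrE ?equimarginal_ge// (le_trans mu0)// equimarginal_ge.
have le_p j : P j -> equimarginal (c j) mu <= mu + e / 3.
  move=> Pj; apply: equimarginal_overshoot => //; first by lra.
  by have := c_ge j Pj; lra.
have le_Amu : A <= mu + e / 3.
  have mue0 : 0 <= mu + e / 3 by lra.
  rewrite -(@ler_sqr R) ?nnegrE// -(ler_pM2l cardP0) -sumE -constE.
  apply: ler_sum => j Pj; rewrite ler_sqr ?nnegrE ?le_p//.
  by rewrite (le_trans mu0)// equimarginal_ge.
have := le_p i Pi; have := equimarginal_ge (c0 i) mu0.
rewrite ler_norml; lra.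
Qed.

(** The increment of the correction [(p - c)_+^3] from [p = a] to [p = b] is largest
for [c = 0], where it equals [b^3 - a^3]; so at least the fraction
[1 / 3 - 1 / 12 = 1 / 4] of [b^3 - a^3] is gained. *)
Lemma energy_loss_growth (R : realType) (a b c : R) :
  0 <= c -> 0 <= a -> a <= b ->
  (b ^+ 3 - a ^+ 3) / 4 <= energy_loss b c - energy_loss a c.
Proof.
move=> c0 a0 le_ab.
have cube_ge x y : 0 <= x -> x <= y -> x ^+ 3 <= y ^+ 3 :> R.
  by move=> x0 le_xy; rewrite lerXn2r ?nnegrE// (le_trans x0).
case: (leP b c) => [le_bc|/ltW le_cb].
  rewrite !energy_loss_le// ?(le_trans le_ab)//.
  by have := cube_ge _ _ a0 le_ab; lra.
rewrite (energy_loss_ge le_cb).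
case: (leP a c) => [le_ac|/ltW le_ca].
  rewrite energy_loss_le//.
  have le1 : (b - c) ^+ 3 <= (b - a) ^+ 3 by apply: cube_ge; lra.
  have : (b - a) ^+ 3 <= b ^+ 3 - a ^+ 3.
    rewrite -subr_ge0.
    have -> : b ^+ 3 - a ^+ 3 - (b - a) ^+ 3 = 3 * (a * b * (b - a)) by ring.
    by rewrite !mulr_ge0// ?subr_ge0// (le_trans a0).
  lra.
rewrite energy_loss_ge//.
suff : 0 <= b ^+ 3 - a ^+ 3 - ((b - c) ^+ 3 - (a - c) ^+ 3) by lra.
have -> : b ^+ 3 - a ^+ 3 - ((b - c) ^+ 3 - (a - c) ^+ 3) =
          3 * (c * (b - a) * (b + (a - c))) by ring.
rewrite !mulr_ge0//; lra.
Qed.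

Lemma energy_loss_ub (R : realType) (c p : R) :
  energy_loss p c <= (p ^+ 3 - c ^+ 3) / 3.
Proof.
case: (leP p c) => [le_pc|/ltW le_cp]; first by rewrite energy_loss_le.
rewrite energy_loss_ge// lerBlDr lerDl divr_ge0//.
by rewrite exprn_ge0// subr_ge0.
Qed.

(** Gain [(b^3 - a^3) / 4] on the edge [k] against a loss of at most
[a (b^2 - a^2) / 3] on the others, where [a = w k] and [b = sqrt S]. The
difference is [(b - a) (3 b^2 - a b - a^2) / 12]. *)
Lemma sum_energy_loss_concentrated_lt (R : realType) (I : finType)
    (P : pred I) (c w : I -> R) (k : I) (S : R) :
  (forall i, 0 <= c i) -> (forall i, 0 <= w i) -> P k ->
  (forall i, P i -> w i <= w k) -> \sum_(i | P i) w i ^+ 2 = S ->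
  w k < Num.sqrt S ->
  \sum_(i | P i) energy_loss (w i) (c i) <
  \sum_(i | P i) energy_loss (if i == k then Num.sqrt S else 0) (c i).
Proof.
move=> c0 w0 Pk w_le sumE; set b := Num.sqrt S; set a := w k => lt_ab.
have a0 : 0 <= a by exact: w0.
have b2 : b ^+ 2 = S.
  by rewrite sqr_sqrtr// -sumE sumr_ge0// => j _; exact: sqr_ge0.
have restE : \sum_(i | P i && (i != k)) w i ^+ 2 = b ^+ 2 - a ^+ 2.
  by rewrite b2 -sumE [in RHS](bigD1 k)//= addrC addrK.
rewrite (bigD1 k)//= [ltRHS](bigD1 k)//= eqxx -subr_gt0 opprD addrACA.
rewrite -sumrB -[X in _ + X]opprK -sumrN subr_gt0.
have grow := energy_loss_growth (c0 k) a0 (ltW lt_ab).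
apply: (lt_le_trans _ grow).
have : \sum_(i | P i && (i != k))
    - (energy_loss (if i == k then b else 0) (c i) - energy_loss (w i) (c i))
    <= \sum_(i | P i && (i != k)) a / 3 * w i ^+ 2.
  apply: ler_sum => i /andP[Pi /negPf ->].
  rewrite opprB (energy_loss_le (c0 i)).
  have := energy_loss_ub (c i) (w i).
  have : w i ^+ 2 * w i <= w i ^+ 2 * a by rewrite ler_wpM2l ?sqr_ge0 ?w_le.
  lra.
rewrite -mulr_sumr restE => /le_lt_trans; apply.
rewrite -subr_gt0.
have -> : (b ^+ 3 - a ^+ 3) / 4 - a / 3 * (b ^+ 2 - a ^+ 2) =
  (b - a) * (b ^+ 2 + (b - a) * (2 * b + a)) / 12 by field.
have b0 : 0 < b by exact: le_lt_trans lt_ab.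
rewrite divr_gt0// mulr_gt0 ?subr_gt0// ltr_pwDl ?exprn_gt0//.
by rewrite mulr_ge0// ?subr_ge0 ?ltW//; lra.
Qed.

(** * Values around a vertex *)

(** A loop would be a directed cycle of length one. *)
Lemma D_outNin (R : realType) (G : directed_metric_tree R) (v : vertex G)
    (j : 'I_(edge_count G)) :
  j \in D_out v -> j \notin D_in v.
Proof.
rewrite !inE => /eqP srcj; apply/negP => /eqP tgtj.
suff : [:: v] = [::] by [].
apply: (@no_directed_cycle _ G); rewrite /= andbT.
by apply/existsP; exists j; rewrite srcj tgtj !eqxx.
Qed.

Lemma incident_outE (R : realType) (G : directed_metric_tree R)
    (v : vertex G) (j : incident v) :
  (val j \in D_out v) = (val j \notin D_in v).
Proof.
apply/idP/idP => [|notin]; first exact: D_outNin.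
by have := valP j; rewrite finset.in_setU (negPf notin).
Qed.

Lemma card_incident_out (R : realType) (G : directed_metric_tree R)
    (v : vertex G) :
  #|fun j : incident v => val j \in D_out v| = deg_minus v.
Proof.
rewrite /deg_minus -!sum1_card.
rewrite -(@big_sub_cond _ 0%N addn _ (mem (D_in v :|: D_out v))
            (fun j => j \in D_out v) (fun=> 1%N)).
by apply: eq_bigl => j; rewrite finset.in_setU andb_idl// => ->; exact: orbT.
Qed.

Lemma exists_first_out (R : realType) (G : directed_metric_tree R)
    (v : vertex G) : ~~ sink v -> exists k : incident v, first_out k.
Proof.
move=> /finset.set0Pn[j outj].
have incj : j \in D_in v :|: D_out v by rewrite finset.in_setU outj orbT.
have [k outk mink] := @arg_minnP _ (Sub j incj : incident v)
  (fun i => val i \in D_out v) (fun i => val i : nat) outj.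
by exists k; split => // i outi; exact: mink.
Qed.

(** Twice the total flux [u^2 / 2] that enters the vertex. *)
Definition inflow (R : realType) (G : directed_metric_tree R)
    (v : vertex G) (u : vertex_values v) : R :=
  \sum_(s : incident v | val s \in D_in v) (u s)%:num ^+ 2.

Lemma inflow_ge0 (R : realType) (G : directed_metric_tree R) (v : vertex G)
  (u : vertex_values v) : 0 <= inflow u.
Proof. by apply: sumr_ge0 => s _; exact: sqr_ge0. Qed.

Lemma vertex_values_eq (R : realType) (G : directed_metric_tree R)
    (v : vertex G) (w w' : vertex_values v) :
  (forall j, (w j)%:num = (w' j)%:num) -> w = w'.
Proof. by move=> eqw; apply/funext => j; apply/val_inj/eqw. Qed.

Lemma LC_neq (R : realType) (G : directed_metric_tree R) (v : vertex G)
    (u w w' : vertex_values v) :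
  LC u w -> LC u w' -> w <> w' ->
  exists2 j : incident v, val j \in D_out v & (w j)%:num != (w' j)%:num.
Proof.
move=> uw uw' neq; apply: contrapT => noj; apply: neq.
apply: vertex_values_eq => j.
have [inj|outj] := boolP (val j \in D_in v); first by rewrite uw// uw'.
apply/eqP; apply: contrapT => /negP neqj; apply: noj.
by exists j => //; rewrite incident_outE.
Qed.

Lemma LC_inflow (R : realType) (G : directed_metric_tree R) (v : vertex G)
    (u w : vertex_values v) : LC u w -> inflow w = inflow u.
Proof. by move=> uw; apply: eq_bigr => j inj; rewrite uw. Qed.

Lemma energy_change_LC (R : realType) (G : directed_metric_tree R)
    (v : vertex G) (u w : vertex_values v) : LC u w ->
  energy_change u w =
  \sum_(j : incident v | val j \in D_out v)
    energy_loss (w j)%:num (u j)%:num.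
Proof.
move=> uw; rewrite /energy_change big1 ?add0r// => j inj.
by rewrite uw// energy_lossxx.
Qed.

(** Every vector satisfying (LC) with respect to [u] has this form. *)
Definition set_out (R : realType) (G : directed_metric_tree R) (v : vertex G)
    (u f : vertex_values v) : vertex_values v :=
  fun j => if val j \in D_in v then u j else f j.

Lemma set_out_LC (R : realType) (G : directed_metric_tree R) (v : vertex G)
  (u f : vertex_values v) : LC u (set_out u f).
Proof. by move=> j inj; rewrite /set_out inj. Qed.

Lemma set_out_out (R : realType) (G : directed_metric_tree R) (v : vertex G)
  (u f : vertex_values v) (j : incident v) :
  val j \in D_out v -> set_out u f j = f j.
Proof. by rewrite /set_out incident_outE => /negPf ->. Qed.

Lemma set_out_kirchhoff (R : realType) (G : directed_metric_tree R)
    (v : vertex G) (u f : vertex_values v) :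
  \sum_(j : incident v | val j \in D_out v) (f j)%:num ^+ 2 = inflow u ->
  kirchhoff (set_out u f).
Proof.
move=> fE; rewrite /kirchhoff -/(inflow _) (LC_inflow (set_out_LC _ _)) -fE.
by apply: eq_bigr => j outj; rewrite set_out_out.
Qed.

(** * From strict optimality to the uniqueness of the solvers *)

Lemma unique_TSm (R : realType) (G : directed_metric_tree R) (v : vertex G)
    (TS : vertex_values v -> vertex_values v) :
  transmission_solver TS -> (forall u, LC u (TS u)) ->
  (forall u w, kirchhoff w -> LC u w -> w <> TS u ->
     energy_change u (TS u) < energy_change u w) ->
  unique (@is_TSm R G v) TS.
Proof.
move=> kTS lcTS opt; split.
  split => // u; split => // w kw uw.
  have [->//|neq] := pselect (w = TS u).
  exact/ltW/opt.
move=> TS' [kTS' optTS']; apply/funext => u; apply: contrapT => neq.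
have [uTS' le] := optTS' u.
have := opt u (TS' u) (kTS' u) uTS' (fun e => neq (esym e)).
by rewrite ltNge le.
Qed.

Lemma unique_TSM (R : realType) (G : directed_metric_tree R) (v : vertex G)
    (TS : vertex_values v -> vertex_values v) :
  transmission_solver TS -> (forall u, LC u (TS u) /\ DF (TS u)) ->
  (forall u w, kirchhoff w -> LC u w -> DF w -> w <> TS u ->
     energy_change u w < energy_change u (TS u)) ->
  unique (@is_TSM R G v) TS.
Proof.
move=> kTS lcTS opt; split.
  split => // u; have [uTS dfTS] := lcTS u; do 2!split => //.
  move=> w kw uw dw; have [->//|neq] := pselect (w = TS u).
  exact/ltW/opt.
move=> TS' [kTS' optTS']; apply/funext => u; apply: contrapT => neq.
have [uTS' [dTS' le]] := optTS' u; have [uTS dTS] := lcTS u.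
have := opt u (TS' u) (kTS' u) uTS' dTS' (fun e => neq (esym e)).
by rewrite ltNge le.
Qed.

(** The limit of the iterates is unique because the solver being iterated is, and
because limits of real sequences are. *)
Lemma unique_iterated_limit (R : realType) (G : directed_metric_tree R)
    (v : vertex G)
    (Q : (vertex_values v -> vertex_values v) -> Prop)
    (TS TSstar : vertex_values v -> vertex_values v) :
  unique Q TS -> transmission_solver TSstar -> is_iterated_limit TS TSstar ->
  unique (fun TSstar => transmission_solver TSstar /\
            exists TS, unique Q TS /\ is_iterated_limit TS TSstar) TSstar.
Proof.
move=> uTS kTS limTS; split; first by split => //; exists TS.
move=> TSstar' [_ [TS' [[QTS' _] limTS']]].
have eqTS : TS = TS' by case: uTS => _; exact.
apply/funext => u; apply: vertex_values_eq => j.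
move: (limTS' u j); rewrite -eqTS => lim'.
exact: cvg_unique (limTS u j) lim'.
Qed.

(** * The minimal solver *)

Definition equipartition (R : realType) (G : directed_metric_tree R)
    (v : vertex G) (u : vertex_values v) : {nonneg R} :=
  NngNum (mulr_ge0 (divr_ge0 ler01 (sqrtr_ge0 (deg_minus v)%:R))
                   (sqrtr_ge0 (inflow u))).

Lemma sqr_equipartition (R : realType) (G : directed_metric_tree R)
    (v : vertex G) (u : vertex_values v) : ~~ sink v ->
  (deg_minus v)%:R * (equipartition u)%:num ^+ 2 = inflow u.
Proof.
move=> v_not_sink; rewrite /= exprMn sqr_sqrtr ?inflow_ge0// expr_div_n.
rewrite sqr_sqrtr// expr1n mulrA div1r mulfV ?mul1r//.
by rewrite pnatr_eq0 cards_eq0.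
Qed.

(** Besides existence and uniqueness, the form of the solver is recorded, as the
study of its iterates relies on it. *)
Lemma exists_TSm (R : realType) (G : directed_metric_tree R) (v : vertex G) :
  ~~ sink v -> exists TS, [/\ unique (@is_TSm R G v) TS,
    forall u, LC u (TS u) &
    forall u, exists2 mu, 0 <= mu & forall j, val j \in D_out v ->
      (TS u j)%:num = equimarginal (u j)%:num mu].
Proof.
move=> v_not_sink.
have [k [outk _]] := exists_first_out v_not_sink.
have level (u : vertex_values v) : exists mu : {nonneg R},
    \sum_(j : incident v | val j \in D_out v)
      equimarginal (u j)%:num mu%:num ^+ 2 = inflow u.
  have [|//||mu mu0 muE] := @exists_equimarginal_level R _
    (fun j => val j \in D_out v) (fun j => (u j)%:num) (inflow u).
  - by exists k.
  - exact: inflow_ge0.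
  - by exists (NngNum mu0).
have [mu muE] := choice level.
have eq0 u (j : incident v) : 0 <= equimarginal (u j)%:num (mu u)%:num.
  by rewrite (le_trans (ge0 (mu u)))// equimarginal_ge.
pose TS u := set_out u (fun j => NngNum (eq0 u j)).
have TSout u j : val j \in D_out v ->
    (TS u j)%:num = equimarginal (u j)%:num (mu u)%:num.
  by move=> outj; rewrite /TS set_out_out.
have kTS : transmission_solver TS by move=> u; exact/set_out_kirchhoff/muE.
exists TS; split; [apply: unique_TSm => // | |].
- by move=> u; exact: set_out_LC.
- move=> u w kw uw neq; rewrite !energy_change_LC//; last exact: set_out_LC.
  under eq_bigr => j outj do rewrite TSout//.
  apply: sum_energy_loss_equimarginal_lt => //.
    by rewrite muE -(LC_inflow uw) -kw.
  have [j outj neqj] := LC_neq uw (set_out_LC _ _) neq.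
  by exists j => //; rewrite -TSout.
- by move=> u; exact: set_out_LC.
- by move=> u; exists (mu u)%:num => // j; exact: TSout.
Qed.

(** The incoming values, hence the equal distribution, are the same for all
iterates; each step divides the bound on the distance to it by three. *)
Lemma is_iterated_limit_TSm (R : realType) (G : directed_metric_tree R)
    (v : vertex G) (TS : vertex_values v -> vertex_values v) :
  ~~ sink v -> transmission_solver TS -> (forall u, LC u (TS u)) ->
  (forall u, exists2 mu, 0 <= mu & forall j, val j \in D_out v ->
      (TS u j)%:num = equimarginal (u j)%:num mu) ->
  is_iterated_limit TS (fun u => set_out u (fun=> equipartition u)).
Proof.
move=> v_not_sink kTS lcTS eqTS u.
have lcn n : LC u (iter n TS u).
  by elim: n => // n IH j inj; rewrite iterS lcTS// IH.
move=> j; have [inj|] := boolP (val j \in D_in v).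
  rewrite (set_out_LC _ _ inj).
  under eq_cvg => n do rewrite (lcn n _ inj).
  exact: cvg_cst.
rewrite -incident_outE => outj; rewrite set_out_out//.
set A := (equipartition u)%:num.
have A0 : 0 <= A by rewrite /A.
have step w e : LC u w -> 0 <= e ->
    (forall i, val i \in D_out v -> A - e <= (w i)%:num) ->
    forall i, val i \in D_out v -> `|(TS w i)%:num - A| <= e / 3.
  move=> uw e0 w_ge i outi; have [mu mu0 muE] := eqTS w.
  rewrite muE//.
  apply: (equimarginal_contraction (P := fun i => val i \in D_out v)
            (c := fun i => (w i)%:num)) => //.
  rewrite card_incident_out sqr_equipartition// -(LC_inflow uw).
  rewrite -(LC_inflow (lcTS w)) /inflow kTS.
  by apply: eq_bigr => l outl; rewrite muE.
have bound n i : val i \in D_out v ->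
    `|(iter n.+1 TS u i)%:num - A| <= A * 3^-1 ^+ n.+1.
  move=> outi; elim: n i outi => [|n IH] i outi.
    (* Nonnegativity of the initial values is the case [e = A] of the step. *)
    by apply: step => // l _; rewrite subrr.
  rewrite iterS exprSr mulrA; apply: step => //.
    by rewrite mulr_ge0// exprn_ge0.
  by move=> l outl; have := IH l outl; rewrite ler_norml => /andP[]; lra.
(* Shifted by one: the initial values need not lie within [A] of [A]. *)
rewrite -(cvg_shiftS (fun n => (iter n TS u j)%:num)).
apply/subr_cvg0/norm_cvg0P.
apply: (@squeeze_cvgr _ _ _ _ (fun=> 0) (fun n => A * 3^-1 ^+ n.+1)).
- by apply: nearW => n; rewrite normr_ge0 bound.
- exact: cvg_cst.
- rewrite (cvg_shiftS (geometric A 3^-1)); apply: cvg_geometric.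
  by rewrite ger0_norm// invf_lt1// ltr1n.
Qed.

(** * The maximal solver *)

Definition first_takes_all (R : realType) (G : directed_metric_tree R)
    (v : vertex G) (k : incident v) (u : vertex_values v) : vertex_values v :=
  set_out u (fun j => if j == k then NngNum (sqrtr_ge0 (inflow u)) else 0%:nng).

Lemma first_takes_all_LC (R : realType) (G : directed_metric_tree R)
  (v : vertex G) (k : incident v) (u : vertex_values v) :
  LC u (first_takes_all k u).
Proof. exact: set_out_LC. Qed.

Lemma first_takes_all_out (R : realType) (G : directed_metric_tree R)
    (v : vertex G) (k : incident v) (u : vertex_values v) (j : incident v) :
  val j \in D_out v -> (first_takes_all k u j)%:num =
    if j == k then Num.sqrt (inflow u) else 0.
Proof. by move=> outj; rewrite /first_takes_all set_out_out//; case: ifP. Qed.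

Lemma first_takes_all_kirchhoff (R : realType) (G : directed_metric_tree R)
    (v : vertex G) (k : incident v) :
  val k \in D_out v -> transmission_solver (first_takes_all k).
Proof.
move=> outk u; apply: set_out_kirchhoff.
rewrite (bigD1 k)//= eqxx sqr_sqrtr ?inflow_ge0// big1 ?addr0//.
by move=> j /andP[_ /negPf ->]; rewrite expr0n.
Qed.

(** By (DF) the first edge carries the largest outgoing value, so the
concentration lemma applies to any competitor that leaves it below
[sqrt (inflow u)]; a competitor reaching that value leaves nothing for the other
edges. *)
Lemma unique_TSM_first_takes_all (R : realType) (G : directed_metric_tree R)
    (v : vertex G) (k : incident v) :
  first_out k -> unique (@is_TSM R G v) (first_takes_all k).
Proof.
move=> [outk mink]; apply: unique_TSM.
- exact: first_takes_all_kirchhoff.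
- move=> u; split; first exact: first_takes_all_LC.
  move=> j l outj outl lt_jl; rewrite !first_takes_all_out//.
  have -> : (l == k) = false.
    by apply/eqP => lk; move: (mink j outj); rewrite -lk leqNgt lt_jl.
  by case: ifP => _; rewrite ?sqrtr_ge0.
- move=> u w kw uw dw neq; rewrite !energy_change_LC//; last exact: first_takes_all_LC.
  under [ltRHS]eq_bigr => j outj do rewrite first_takes_all_out//.
  have sumE : \sum_(j : incident v | val j \in D_out v) (w j)%:num ^+ 2 =
      inflow u by rewrite -(LC_inflow uw) -kw.
  apply: (sum_energy_loss_concentrated_lt (w := fun j => (w j)%:num)
            (c := fun j => (u j)%:num)) => //.
    move=> j outj; have := mink j outj.
    by rewrite leq_eqVlt => /predU1P[/val_inj/val_inj ->//|/dw]; exact.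
  rewrite ltNge; apply/negP => le_Sk; apply: neq.
  have restE : \sum_(j : incident v | (val j \in D_out v) && (j != k))
      (w j)%:num ^+ 2 = inflow u - (w k)%:num ^+ 2.
    by rewrite -sumE [in RHS](bigD1 k)//= addrC addrK.
  have le_kS : inflow u <= (w k)%:num ^+ 2.
    by rewrite -(sqr_sqrtr (inflow_ge0 u)) ler_sqr ?nnegrE ?sqrtr_ge0.
  have rest0 : 0 <= \sum_(j : incident v | (val j \in D_out v) && (j != k))
      (w j)%:num ^+ 2 by apply: sumr_ge0 => j _; exact: sqr_ge0.
  have kE : (w k)%:num ^+ 2 = inflow u by lra.
  apply: vertex_values_eq => j.
  have [inj|] := boolP (val j \in D_in v).
    by rewrite uw// first_takes_all_LC.
  rewrite -incident_outE => outj; rewrite first_takes_all_out//.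
  have [->|neq_jk] := eqVneq j k.
    by rewrite -kE sqrtr_sqr ger0_norm.
  apply/eqP; rewrite -sqrf_eq0; apply/eqP.
  have sq0 (i : incident v) : (val i \in D_out v) && (i != k) ->
    0 <= (w i)%:num ^+ 2 by move=> _; exact: sqr_ge0.
  apply: (psumr_eq0P sq0); first by rewrite restE kE subrr.
  by rewrite outj neq_jk.
Qed.

(** The solver only reads the incoming values, which it preserves. *)
Lemma is_iterated_limit_first_takes_all (R : realType)
    (G : directed_metric_tree R) (v : vertex G) (k : incident v) :
  is_iterated_limit (first_takes_all k) (first_takes_all k).
Proof.
have idem u : first_takes_all k (first_takes_all k u) = first_takes_all k u.
  apply: vertex_values_eq => j; have [inj|] := boolP (val j \in D_in v).
    by rewrite (first_takes_all_LC k _ inj).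
  rewrite -incident_outE => outj; rewrite !first_takes_all_out//.
  by rewrite (LC_inflow (first_takes_all_LC k u)).
move=> u j; rewrite -(cvg_shiftS (fun n => (iter n _ u j)%:num)).
suff iterE n : iter n.+1 (first_takes_all k) u = first_takes_all k u.
  by apply: cvg_near_cst; apply: nearW => n; rewrite /mk_sequence iterE.
by elim: n => // n IH; rewrite iterS IH idem.
Qed.

(** * Both solvers at a vertex that is not a sink *)

Theorem theorem1 (R : realType) (G : directed_metric_tree R) (v : vertex G)
    (v_not_sink : ~~ sink v) :
  (exists TSm : vertex_values v -> vertex_values v,
     unique (@is_minimal_solver R G v) TSm /\
     forall (u : vertex_values v) (j : incident v),
       (val j \in D_in v -> (TSm u j)%:num = (u j)%:num) /\
       (val j \in D_out v ->
          (TSm u j)%:num =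
          1 / Num.sqrt (deg_minus v)%:R *
          Num.sqrt (\sum_(s : incident v | val s \in D_in v)
                      (u s)%:num ^+ 2))) /\
  (exists TSM : vertex_values v -> vertex_values v,
     unique (@is_maximal_solver R G v) TSM /\
     exists k : incident v, first_out k /\
     forall (u : vertex_values v) (j : incident v),
       (val j \in D_in v -> (TSM u j)%:num = (u j)%:num) /\
       (j = k ->
          (TSM u j)%:num =
          Num.sqrt (\sum_(s : incident v | val s \in D_in v)
                      (u s)%:num ^+ 2)) /\
       (val j \in D_out v -> j <> k -> (TSM u j)%:num = 0)).
Proof.
split.
  have [TS [uTS lcTS eqTS]] := exists_TSm v_not_sink.
  have kTS : transmission_solver TS by case: uTS => -[].
  exists (fun u => set_out u (fun=> equipartition u)); split.
    apply: (unique_iterated_limit uTS); last exact: is_iterated_limit_TSm.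
    move=> u; apply: set_out_kirchhoff.
    by rewrite sumr_const card_incident_out -mulr_natl sqr_equipartition.
  move=> u j; split => [inj|outj]; first by rewrite set_out_LC.
  by rewrite set_out_out.
have [k firstk] := exists_first_out v_not_sink.
exists (first_takes_all k); split.
  apply: (unique_iterated_limit (unique_TSM_first_takes_all firstk)).
    by case: firstk => outk _; exact: first_takes_all_kirchhoff.
  exact: is_iterated_limit_first_takes_all.
exists k; split => // u j; have [outk _] := firstk.
split=> [inj|]; first by rewrite first_takes_all_LC.
split=> [->|outj /eqP/negPf neq_jk]; first by rewrite first_takes_all_out// eqxx.
by rewrite first_takes_all_out// neq_jk.
Qed.
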